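(* For any term $\vdash C : \mathsf{Nat}$ in PCF, there is a term of finitary HEPCF $C_f \triangleq \mathtt{let}~a = [\![C]\!]~\mathtt{in}~(a~())$ such that $\vdash_E C_f : \mathsf{Unit}$ and $ET(C_f)$ represents the normal form of $C$ (if it exists; otherwise $ET(C_f) \equiv \bot$).
   Context: PCF here is fine-grained call-by-value PCF with a type $\mathsf{Nat}$ ($0$, $\mathtt{succ}(V)$, $\mathtt{case}(V;0 \mapsto C;\mathtt{succ}(x)\mapsto D)$) and fixpoints. HEPCF is the call-by-value calculus with finite base types only, algebraic operations, and (deep) effect handlers $\mathtt{handle}_H~C$, whose handler clauses $\sigma_i(x;r) \mapsto C_i$ receive the continuation $r$ and whose computations are typed $\Gamma \vdash_E C : T$ with $E$ the set of available effects. Fix $E = \{\sigma : \mathsf{Unit} \rightsquigarrow 1\}$. The translation $[\![\cdot]\!]$ from PCF to HEPCF sets $[\![\mathsf{Nat}]\!] = \mathsf{Unit} \rightarrow_E \mathsf{Unit}$, $[\![T \rightarrow U]\!] = [\![T]\!] \rightarrow_E [\![U]\!]$, $[\![0]\!] = \lambda x.\mathtt{return}(())$, $[\![\mathtt{succ}(V)]\!] = \lambda x.\sigma(y.[\![V]\!]~())$, is homomorphic on the other constructs, and translates $\mathtt{case}$ by handling the thunk $[\![V]\!]~()$ with a deep handler that returns a pair (encoded as a function) of a copy of the number and the chosen branch; thus a natural number $n$ is represented by a thunk whose effect tree is $n$ nested $\sigma$ nodes ending in $\mathtt{return}(())$. $ET$ denotes the effect tree of a closed computation; ''represents the normal form''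 means $ET(C_f)$ is this tree encoding of the natural number computed by $C$. *)

(* Defs.v *)
From Stdlib Require Import List Arith Fin Relations ClassicalEpsilon.
Import ListNotations.

(** Both calculi are Curry-style and use de Bruijn indices: index 0 is the
    innermost binder, and a typing context lists the innermost binder first. *)

Definition scons {A : Type} (a : A) (s : nat -> A) (x : nat) : A :=
  match x with 0 => a | S y => s y end.

Definition up_ren (r : nat -> nat) : nat -> nat := scons 0 (fun x => S (r x)).

Module PCF.

Inductive ty : Type :=
| Nat
| Arr (T U : ty).

(** [VLam C] binds one variable in [C], [VFix V] one in [V], [CLet C D] one in
    [D], and [CCase V C D] one in [D] (the predecessor). *)
Inductive val : Type :=
| VVar (x : nat)
| VZero
| VSucc (V : val)
| VLam (C : comp)
| VFix (V : val)
with comp : Type :=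
| CRet (V : val)
| CLet (C D : comp)
| CApp (V W : val)
| CCase (V : val) (C D : comp).

Fixpoint ren_val (r : nat -> nat) (V : val) : val :=
  match V with
  | VVar x => VVar (r x)
  | VZero => VZero
  | VSucc V => VSucc (ren_val r V)
  | VLam C => VLam (ren_comp (up_ren r) C)
  | VFix V => VFix (ren_val (up_ren r) V)
  end
with ren_comp (r : nat -> nat) (C : comp) : comp :=
  match C with
  | CRet V => CRet (ren_val r V)
  | CLet C D => CLet (ren_comp r C) (ren_comp (up_ren r) D)
  | CApp V W => CApp (ren_val r V) (ren_val r W)
  | CCase V C D =>
      CCase (ren_val r V) (ren_comp r C) (ren_comp (up_ren r) D)
  end.

Definition up (s : nat -> val) : nat -> val :=
  scons (VVar 0) (fun x => ren_val S (s x)).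

Fixpoint subst_val (s : nat -> val) (V : val) : val :=
  match V with
  | VVar x => s x
  | VZero => VZero
  | VSucc V => VSucc (subst_val s V)
  | VLam C => VLam (subst_comp (up s) C)
  | VFix V => VFix (subst_val (up s) V)
  end
with subst_comp (s : nat -> val) (C : comp) : comp :=
  match C with
  | CRet V => CRet (subst_val s V)
  | CLet C D => CLet (subst_comp s C) (subst_comp (up s) D)
  | CApp V W => CApp (subst_val s V) (subst_val s W)
  | CCase V C D =>
      CCase (subst_val s V) (subst_comp s C) (subst_comp (up s) D)
  end.

Definition inst_val (V W : val) : val := subst_val (scons W VVar) V.
Definition inst (C : comp) (W : val) : comp := subst_comp (scons W VVar) C.

(** Fixpoints are restricted to function types, so that the closed values of
    type [Nat] are exactly the numerals. *)
Inductive val_typed : list ty -> val -> ty -> Prop :=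
| T_Var G x T :
    nth_error G x = Some T -> val_typed G (VVar x) T
| T_Zero G :
    val_typed G VZero Nat
| T_Succ G V :
    val_typed G V Nat -> val_typed G (VSucc V) Nat
| T_Lam G C T U :
    comp_typed (T :: G) C U -> val_typed G (VLam C) (Arr T U)
| T_Fix G V T U :
    val_typed (Arr T U :: G) V (Arr T U) -> val_typed G (VFix V) (Arr T U)
with comp_typed : list ty -> comp -> ty -> Prop :=
| T_Ret G V T :
    val_typed G V T -> comp_typed G (CRet V) T
| T_Let G C D T U :
    comp_typed G C T -> comp_typed (T :: G) D U -> comp_typed G (CLet C D) U
| T_App G V W T U :
    val_typed G V (Arr T U) -> val_typed G W T -> comp_typed G (CApp V W) U
| T_Case G V C D T :
    val_typed G V Nat -> comp_typed G C T -> comp_typed (Nat :: G) D T ->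
    comp_typed G (CCase V C D) T.

Inductive step : comp -> comp -> Prop :=
| S_Beta C W : step (CApp (VLam C) W) (inst C W)
| S_Fix V W : step (CApp (VFix V) W) (CApp (inst_val V (VFix V)) W)
| S_LetRet V D : step (CLet (CRet V) D) (inst D V)
| S_Let C C' D : step C C' -> step (CLet C D) (CLet C' D)
| S_CaseZero C D : step (CCase VZero C D) C
| S_CaseSucc V C D : step (CCase (VSucc V) C D) (inst D V).

Definition steps : relation comp := clos_refl_trans comp step.

Definition normal (C : comp) : Prop := forall C', ~ step C C'.

Definition normal_form_of (C N : comp) : Prop := steps C N /\ normal N.

Fixpoint numeral (n : nat) : val :=
  match n with 0 => VZero | S m => VSucc (numeral m) end.

End PCF.

Module HEPCF.

(** [Fin n] has exactly [n] elements: every base type is finite. *)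
Inductive base : Type :=
| Unit
| Fin (n : nat).

(** An operation symbol carries its own signature: [Op k B n] is an operation
    [B ~> n], with parameter in [B] and [n]-ary continuation. *)
Record op : Type := Op { op_name : nat; op_dom : base; op_ar : nat }.

Definition op_eq_dec (o o' : op) : {o = o'} + {o <> o'}.
Proof. repeat decide equality. Defined.

(** A finite set of available operations; only membership matters. *)
Definition effects : Type := list op.

(** [Arr T E U] is the type of functions from [T] to [U] with latent effects
    [E]. *)
Inductive ty : Type :=
| Base (B : base)
| Arr (T : ty) (E : effects) (U : ty).

(** In addition to the binders shared with PCF, [COp o V C] is [o(V; x.C)] and
    binds [x] in [C]; [HRet C] is the return clause and binds one variable in
    [C]; [HOp o C H] adds the clause [o(x; r) |-> C] to [H], where [r] has
    index 0 and [x] has index 1 in [C]. *)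
Inductive val : Type :=
| VVar (x : nat)
| VUnit
| VFin {n : nat} (i : Fin.t n)
| VLam (C : comp)
| VFix (V : val)
with comp : Type :=
| CRet (V : val)
| CLet (C D : comp)
| CApp (V W : val)
| CCase {n : nat} (V : val) (Cs : Fin.t n -> comp)
| COp (o : op) (V : val) (C : comp)
| CHandle (H : handler) (C : comp)
with handler : Type :=
| HRet (C : comp)
| HOp (o : op) (C : comp) (H : handler).

Fixpoint ren_val (r : nat -> nat) (V : val) : val :=
  match V with
  | VVar x => VVar (r x)
  | VUnit => VUnit
  | VFin i => VFin i
  | VLam C => VLam (ren_comp (up_ren r) C)
  | VFix V => VFix (ren_val (up_ren r) V)
  end
with ren_comp (r : nat -> nat) (C : comp) : comp :=
  match C with
  | CRet V => CRet (ren_val r V)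
  | CLet C D => CLet (ren_comp r C) (ren_comp (up_ren r) D)
  | CApp V W => CApp (ren_val r V) (ren_val r W)
  | CCase V Cs => CCase (ren_val r V) (fun i => ren_comp r (Cs i))
  | COp o V C => COp o (ren_val r V) (ren_comp (up_ren r) C)
  | CHandle H C => CHandle (ren_handler r H) (ren_comp r C)
  end
with ren_handler (r : nat -> nat) (H : handler) : handler :=
  match H with
  | HRet C => HRet (ren_comp (up_ren r) C)
  | HOp o C H => HOp o (ren_comp (up_ren (up_ren r)) C) (ren_handler r H)
  end.

Definition up (s : nat -> val) : nat -> val :=
  scons (VVar 0) (fun x => ren_val S (s x)).

Fixpoint subst_val (s : nat -> val) (V : val) : val :=
  match V with
  | VVar x => s x
  | VUnit => VUnit
  | VFin i => VFin i
  | VLam C => VLam (subst_comp (up s) C)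
  | VFix V => VFix (subst_val (up s) V)
  end
with subst_comp (s : nat -> val) (C : comp) : comp :=
  match C with
  | CRet V => CRet (subst_val s V)
  | CLet C D => CLet (subst_comp s C) (subst_comp (up s) D)
  | CApp V W => CApp (subst_val s V) (subst_val s W)
  | CCase V Cs => CCase (subst_val s V) (fun i => subst_comp s (Cs i))
  | COp o V C => COp o (subst_val s V) (subst_comp (up s) C)
  | CHandle H C => CHandle (subst_handler s H) (subst_comp s C)
  end
with subst_handler (s : nat -> val) (H : handler) : handler :=
  match H with
  | HRet C => HRet (subst_comp (up s) C)
  | HOp o C H => HOp o (subst_comp (up (up s)) C) (subst_handler s H)
  end.

Definition inst_val (V W : val) : val := subst_val (scons W VVar) V.
Definition inst (C : comp) (W : val) : comp := subst_comp (scons W VVar) C.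
Definition inst2 (C : comp) (X R : val) : comp :=
  subst_comp (scons R (scons X VVar)) C.

Fixpoint ret_clause (H : handler) : comp :=
  match H with HRet C => C | HOp _ _ H => ret_clause H end.

Fixpoint op_clause (H : handler) (o : op) : option comp :=
  match H with
  | HRet _ => None
  | HOp o' C H => if op_eq_dec o' o then Some C else op_clause H o
  end.

(** [handler_typed G E T E' U H]: in context [G], [H] turns computations of type
    [T] with effects [E] into computations of type [U] with effects [E'].
    Operations without a clause are forwarded, hence must belong to [E']. *)
Inductive val_typed : list ty -> val -> ty -> Prop :=
| T_Var G x T :
    nth_error G x = Some T -> val_typed G (VVar x) T
| T_Unit G :
    val_typed G VUnit (Base Unit)
| T_Fin G n (i : Fin.t n) :
    val_typed G (VFin i) (Base (Fin n))
| T_Lam G C T E U :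
    comp_typed (T :: G) E C U -> val_typed G (VLam C) (Arr T E U)
| T_Fix G V T E U :
    val_typed (Arr T E U :: G) V (Arr T E U) ->
    val_typed G (VFix V) (Arr T E U)
with comp_typed : list ty -> effects -> comp -> ty -> Prop :=
| T_Ret G E V T :
    val_typed G V T -> comp_typed G E (CRet V) T
| T_Let G E C D T U :
    comp_typed G E C T -> comp_typed (T :: G) E D U ->
    comp_typed G E (CLet C D) U
| T_App G E V W T U :
    val_typed G V (Arr T E U) -> val_typed G W T ->
    comp_typed G E (CApp V W) U
| T_Case G E n V (Cs : Fin.t n -> comp) T :
    val_typed G V (Base (Fin n)) -> (forall i, comp_typed G E (Cs i) T) ->
    comp_typed G E (CCase V Cs) T
| T_Op G E o V C T :
    In o E -> val_typed G V (Base (op_dom o)) ->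
    comp_typed (Base (Fin (op_ar o)) :: G) E C T ->
    comp_typed G E (COp o V C) T
| T_Handle G E E' H C T U :
    comp_typed G E C T -> handler_typed G E T E' U H ->
    comp_typed G E' (CHandle H C) U
with handler_typed :
  list ty -> effects -> ty -> effects -> ty -> handler -> Prop :=
| T_Handler G E T E' U H :
    (forall o, In o E -> op_clause H o = None -> In o E') ->
    comp_typed (T :: G) E' (ret_clause H) U ->
    (forall o C, op_clause H o = Some C ->
       comp_typed
         (Arr (Base (Fin (op_ar o))) E' U :: Base (op_dom o) :: G) E' C U) ->
    handler_typed G E T E' U H.

Inductive step : comp -> comp -> Prop :=
| S_Beta C W : step (CApp (VLam C) W) (inst C W)
| S_Fix V W : step (CApp (VFix V) W) (CApp (inst_val V (VFix V)) W)
| S_LetRet V D : step (CLet (CRet V) D) (inst D V)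
| S_LetOp o V C D :
    step (CLet (COp o V C) D) (COp o V (CLet C (ren_comp (up_ren S) D)))
| S_Let C C' D : step C C' -> step (CLet C D) (CLet C' D)
| S_Case n (i : Fin.t n) Cs : step (CCase (VFin i) Cs) (Cs i)
| S_HandleRet H V : step (CHandle H (CRet V)) (inst (ret_clause H) V)
| S_HandleOp H o V C D :
    op_clause H o = Some D ->
    step (CHandle H (COp o V C))
         (inst2 D V (VLam (CHandle (ren_handler S H) C)))
| S_HandleForward H o V C :
    op_clause H o = None ->
    step (CHandle H (COp o V C)) (COp o V (CHandle (ren_handler S H) C))
| S_Handle H C C' : step C C' -> step (CHandle H C) (CHandle H C').

Definition steps : relation comp := clos_refl_trans comp step.

Definition terminal (C : comp) : Prop :=
  match C with CRet _ | COp _ _ _ => True | _ => False end.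

(** Possibly infinite trees, with one child per element of the arity. *)
CoInductive tree : Type :=
| Bot
| Leaf (V : val)
| Node (o : op) (V : val) (ts : Fin.t (op_ar o) -> tree).

CoInductive tree_eq : tree -> tree -> Prop :=
| Eq_Bot : tree_eq Bot Bot
| Eq_Leaf V : tree_eq (Leaf V) (Leaf V)
| Eq_Node o V ts us :
    (forall i, tree_eq (ts i) (us i)) ->
    tree_eq (Node o V ts) (Node o V us).

(** The choice below is immaterial: reduction is deterministic, and terminal
    computations do not reduce. *)
Definition eval (C : comp) : option comp :=
  match excluded_middle_informative
          (exists N, steps C N /\ terminal N) with
  | left h => Some (proj1_sig (constructive_indefinite_description _ h))
  | right _ => None
  end.

CoFixpoint ET (C : comp) : tree :=
  match eval C with
  | Some (CRet V) => Leaf V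
  | Some (COp o V D) => Node o V (fun i => ET (inst D (VFin i)))
  | _ => Bot
  end.

End HEPCF.

Module Translation.
Import HEPCF.

Definition sigma : op := Op 0 Unit 1.

Definition Esigma : effects := [sigma].

Definition tr_nat : ty := Arr (Base Unit) Esigma (Base Unit).

Fixpoint tr_ty (T : PCF.ty) : ty :=
  match T with
  | PCF.Nat => tr_nat
  | PCF.Arr T U => Arr (tr_ty T) Esigma (tr_ty U)
  end.

Definition tr_zero : val := VLam (CRet VUnit).

(** [fun x => sigma ((); y. V ())] *)
Definition tr_succ (V : val) : val :=
  VLam (COp sigma VUnit (CApp (ren_val (fun x => 2 + x) V) VUnit)).

(** [fun k => k V W] (curried). In the translation of a [case] of type [T], the
    components have types [tr_nat] and [Unit -> T], and [k] returns a [T]; this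
    single answer type suffices, hence no polymorphism is needed. *)
Definition pair (V W : val) : val :=
  VLam (CLet (CApp (VVar 0) (ren_val S V))
             (CApp (VVar 0) (ren_val (fun x => 2 + x) W))).

(** The deep handler consumes a number and returns the pair of a copy of this
    number and a thunk of the selected branch:
<<
    return x     |-> return (pair 0 (fun _ => C))
    sigma (x; r) |-> let p = r 0 in
                     return (fun k => p (fun n b =>
                                           pair (succ n) (fun _ => D) k))
>>
    [C] lives in the ambient context, and [D] has one more variable, [n]. *)
Definition case_handler (C D : comp) : handler :=
  HOp sigma
    (CLet (CApp (VVar 0) (VFin (@Fin.F1 0)))
      (CRet (VLam (CApp (VVar 1)
        (VLam (CRet (VLam
          (CApp (pair (tr_succ (VVar 1))
                      (VLam (ren_comp (scons 2 (fun x => 7 + x)) D)))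
                (VVar 2)))))))))
  (HRet (CRet (pair tr_zero (VLam (ren_comp (fun x => 2 + x) C))))).

(** [let p = handle (V ()) in p (fun n b => b ())] *)
Definition tr_case (V : val) (C D : comp) : comp :=
  CLet (CHandle (case_handler C D) (CApp V VUnit))
       (CApp (VVar 0) (VLam (CRet (VLam (CApp (VVar 0) VUnit))))).

Fixpoint tr_val (V : PCF.val) : val :=
  match V with
  | PCF.VVar x => VVar x
  | PCF.VZero => tr_zero
  | PCF.VSucc V => tr_succ (tr_val V)
  | PCF.VLam C => VLam (tr_comp C)
  | PCF.VFix V => VFix (tr_val V)
  end
with tr_comp (C : PCF.comp) : comp :=
  match C with
  | PCF.CRet V => CRet (tr_val V)
  | PCF.CLet C D => CLet (tr_comp C) (tr_comp D)
  | PCF.CApp V W => CApp (tr_val V) (tr_val W)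
  | PCF.CCase V C D => tr_case (tr_val V) (tr_comp C) (tr_comp D)
  end.

Fixpoint nat_tree (n : nat) : tree :=
  match n with
  | 0 => Leaf VUnit
  | S m => Node sigma VUnit (fun _ => nat_tree m)
  end.

End Translation.

(* Main.v *)
(** The translation commutes with substitution on the nose, and the deep handler
    of [case] rebuilds exactly the translated predecessor while it consumes a
    numeral. Hence every PCF step between closed typed computations is simulated
    by one or more HEPCF steps between their translations, with no equivalence
    in between. A normal form of type [Nat] is a numeral, whose translated
    thunk unfolds to the expected tree; and as HEPCF reduction is deterministic,
    an infinite PCF reduction leaves the translation without terminal reduct. *)

From Stdlib Require Import List Relations Eqdep_dec PeanoNat
  FunctionalExtensionality Transitive_Closure ClassicalEpsilon.
Require Import Defs.
Import ListNotations HEPCF Translation.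

(** * Substitution in HEPCF *)

Scheme val_mind := Induction for val Sort Prop
  with comp_mind := Induction for comp Sort Prop
  with handler_mind := Induction for handler Sort Prop.
Combined Scheme syntax_ind from val_mind, comp_mind, handler_mind.

Ltac ext_cases :=
  apply functional_extensionality; intros []; cbn; auto.

(** [up_lemma] supplies the binder case; for [ren_subst] and [subst_subst] it rests on the laws
    proved before them. Extensionality deals with the branch families of [CCase]. *)
Ltac induct_syntax up_lemma :=
  apply syntax_ind; cbn; intros; f_equal; try (apply functional_extensionality; intro);
  repeat match goal with h : context [_ = _] |- _ => rewrite h end;
  rewrite ?up_lemma; reflexivity.

Lemma up_ren_comp r r' :
  (fun x => up_ren r' (up_ren r x)) = up_ren (fun x => r' (r x)).
Proof. ext_cases. Qed.

Lemma ren_ren :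
  (forall V r r', ren_val r' (ren_val r V) = ren_val (fun x => r' (r x)) V) /\
  (forall C r r', ren_comp r' (ren_comp r C) = ren_comp (fun x => r' (r x)) C) /\
  (forall H r r',
     ren_handler r' (ren_handler r H) = ren_handler (fun x => r' (r x)) H).
Proof.
  induct_syntax up_ren_comp.
Qed.

Lemma up_subst_ren s r : (fun x => up s (up_ren r x)) = up (fun x => s (r x)).
Proof. ext_cases. Qed.

Lemma subst_ren :
  (forall V r s, subst_val s (ren_val r V) = subst_val (fun x => s (r x)) V) /\
  (forall C r s, subst_comp s (ren_comp r C) = subst_comp (fun x => s (r x)) C) /\
  (forall H r s,
     subst_handler s (ren_handler r H) = subst_handler (fun x => s (r x)) H).
Proof.
  induct_syntax up_subst_ren.
Qed.

Lemma up_ren_subst r s :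
  (fun x => ren_val (up_ren r) (up s x)) = up (fun x => ren_val r (s x)).
Proof.
  ext_cases. rewrite !(proj1 ren_ren). reflexivity.
Qed.

Lemma ren_subst :
  (forall V s r, ren_val r (subst_val s V) = subst_val (fun x => ren_val r (s x)) V) /\
  (forall C s r,
     ren_comp r (subst_comp s C) = subst_comp (fun x => ren_val r (s x)) C) /\
  (forall H s r,
     ren_handler r (subst_handler s H) = subst_handler (fun x => ren_val r (s x)) H).
Proof.
  induct_syntax up_ren_subst.
Qed.

Lemma up_subst_subst s t :
  (fun x => subst_val (up t) (up s x)) = up (fun x => subst_val t (s x)).
Proof.
  ext_cases. rewrite (proj1 subst_ren), (proj1 ren_subst). reflexivity.
Qed.

Lemma subst_subst :
  (forall V s t, subst_val t (subst_val s V) = subst_val (fun x => subst_val t (s x)) V) /\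
  (forall C s t,
     subst_comp t (subst_comp s C) = subst_comp (fun x => subst_val t (s x)) C) /\
  (forall H s t,
     subst_handler t (subst_handler s H)
     = subst_handler (fun x => subst_val t (s x)) H).
Proof.
  induct_syntax up_subst_subst.
Qed.

Lemma up_var r : (fun x => VVar (up_ren r x)) = up (fun x => VVar (r x)).
Proof. ext_cases. Qed.

(** Turns every renaming into a substitution, so that a term under nested renamings and
    substitutions collapses to a single one by [subst_subst]. *)
Lemma ren_as_subst :
  (forall V r, ren_val r V = subst_val (fun x => VVar (r x)) V) /\
  (forall C r, ren_comp r C = subst_comp (fun x => VVar (r x)) C) /\
  (forall H r, ren_handler r H = subst_handler (fun x => VVar (r x)) H).
Proof.
  induct_syntax up_var.
Qed.

Lemma up_id : up VVar = VVar.
Proof. ext_cases. Qed.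

Lemma subst_id :
  (forall V, subst_val VVar V = V) /\ (forall C, subst_comp VVar C = C) /\
  (forall H, subst_handler VVar H = H).
Proof.
  apply syntax_ind; cbn; intros; f_equal; try apply functional_extensionality;
    intros; rewrite ?up_id; auto.
Qed.

(** * Commutation of the translation with substitution *)

Scheme pcf_val_mind := Induction for PCF.val Sort Prop
  with pcf_comp_mind := Induction for PCF.comp Sort Prop.
Combined Scheme pcf_syntax_ind from pcf_val_mind, pcf_comp_mind.

Lemma ren_tr_succ r V : ren_val r (tr_succ V) = tr_succ (ren_val r V).
Proof.
  unfold tr_succ; cbn. rewrite !(proj1 ren_ren). reflexivity.
Qed.

Lemma subst_tr_succ s V : subst_val s (tr_succ V) = tr_succ (subst_val s V).
Proof.
  unfold tr_succ; cbn. rewrite (proj1 subst_ren), (proj1 ren_subst).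
  do 5 f_equal. apply functional_extensionality; intro x; cbn.
  rewrite !(proj1 ren_ren). reflexivity.
Qed.

(** The branches sit in the handler under renamings that skip its own binders. Fusion makes both
    sides substitution instances of [C] and [D], which then agree variable by variable. *)
Lemma subst_tr_case s V C D :
  subst_comp s (tr_case V C D)
  = tr_case (subst_val s V) (subst_comp s C) (subst_comp (up s) D).
Proof.
  unfold tr_case, case_handler, pair. cbn.
  rewrite !(proj1 (proj2 subst_ren)), !(proj1 (proj2 ren_subst)).
  repeat (f_equal; try reflexivity).
  all: apply functional_extensionality; try intros [|x];
    try intro x; cbn; rewrite ?(proj1 ren_ren); reflexivity.
Qed.

Lemma ren_tr_case r V C D :
  ren_comp r (tr_case V C D)
  = tr_case (ren_val r V) (ren_comp r C) (ren_comp (up_ren r) D).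
Proof.
  rewrite !(proj1 (proj2 ren_as_subst)), (proj1 ren_as_subst), subst_tr_case, up_var.
  reflexivity.
Qed.

Lemma tr_ren :
  (forall V r, tr_val (PCF.ren_val r V) = ren_val r (tr_val V)) /\
  (forall C r, tr_comp (PCF.ren_comp r C) = ren_comp r (tr_comp C)).
Proof.
  apply pcf_syntax_ind; cbn -[tr_succ tr_case]; intros;
    rewrite ?ren_tr_succ, ?ren_tr_case; f_equal; auto.
Qed.

Lemma tr_up s : (fun x => tr_val (PCF.up s x)) = up (fun x => tr_val (s x)).
Proof. ext_cases. apply tr_ren. Qed.

Lemma tr_subst :
  (forall V s, tr_val (PCF.subst_val s V) = subst_val (fun x => tr_val (s x)) (tr_val V)) /\
  (forall C s,
     tr_comp (PCF.subst_comp s C) = subst_comp (fun x => tr_val (s x)) (tr_comp C)).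
Proof.
  apply pcf_syntax_ind; cbn -[tr_succ tr_case]; intros;
    rewrite ?subst_tr_succ, ?subst_tr_case, <- ?tr_up; f_equal; auto.
Qed.

Lemma tr_scons W : (fun x => tr_val (scons W PCF.VVar x)) = scons (tr_val W) VVar.
Proof. ext_cases. Qed.

Lemma tr_inst C W : tr_comp (PCF.inst C W) = inst (tr_comp C) (tr_val W).
Proof. unfold PCF.inst, inst. rewrite (proj2 tr_subst), tr_scons. reflexivity. Qed.

Lemma tr_inst_val V W : tr_val (PCF.inst_val V W) = inst_val (tr_val V) (tr_val W).
Proof. unfold PCF.inst_val, inst_val. rewrite (proj1 tr_subst), tr_scons. reflexivity. Qed.

Notation num n := (tr_val (PCF.numeral n)).

Lemma subst_num n s : subst_val s (num n) = num n.
Proof.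
  induction n; [reflexivity|].
  cbn -[tr_succ]. rewrite subst_tr_succ, IHn. reflexivity.
Qed.

Lemma ren_num n r : ren_val r (num n) = num n.
Proof. rewrite (proj1 ren_as_subst). apply subst_num. Qed.

(* Reduces an equation to pointwise equality of the substitutions applied to each
   metavariable. *)
Ltac merge_substs :=
  unfold up, inst, inst_val, inst2, pair, tr_succ; cbn;
  rewrite ?(proj1 ren_as_subst), ?(proj1 (proj2 ren_as_subst));
  rewrite ?(proj1 subst_subst), ?(proj1 (proj2 subst_subst)), ?subst_num.

Ltac compare_substs :=
  repeat progress merge_substs;
  repeat (f_equal; try reflexivity);
  try (apply functional_extensionality; intros [|x];
       repeat progress merge_substs; reflexivity);
  try apply subst_id.

(** * Typing *)

Scheme val_typed_mind := Minimality for val_typed Sort Prop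
  with comp_typed_mind := Minimality for comp_typed Sort Prop
  with handler_typed_mind := Minimality for handler_typed Sort Prop.
Combined Scheme typed_ind from val_typed_mind, comp_typed_mind, handler_typed_mind.

Definition ren_ok {A} (G G' : list A) (r : nat -> nat) : Prop :=
  forall x T, nth_error G x = Some T -> nth_error G' (r x) = Some T.

Lemma ren_ok_up {A} (T : A) G G' r :
  ren_ok G G' r -> ren_ok (T :: G) (T :: G') (up_ren r).
Proof. intros h [|x] U; cbn; auto. Qed.

Lemma ret_clause_ren r H :
  ret_clause (ren_handler r H) = ren_comp (up_ren r) (ret_clause H).
Proof. induction H; cbn; auto. Qed.

Lemma op_clause_ren r H o :
  op_clause (ren_handler r H) o
  = option_map (ren_comp (up_ren (up_ren r))) (op_clause H o).
Proof.
  induction H; cbn; auto. destruct (op_eq_dec _ _); auto.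
Qed.

(** Serves as weakening: [tr_succ], [pair] and [case_handler] place their arguments under additional
    binders. *)
Lemma typed_ren :
  (forall G V T, val_typed G V T ->
     forall G' r, ren_ok G G' r -> val_typed G' (ren_val r V) T) /\
  (forall G E C T, comp_typed G E C T ->
     forall G' r, ren_ok G G' r -> comp_typed G' E (ren_comp r C) T) /\
  (forall G E T E' U H, handler_typed G E T E' U H ->
     forall G' r, ren_ok G G' r -> handler_typed G' E T E' U (ren_handler r H)).
Proof.
  apply typed_ind; cbn; intros; try (econstructor; eauto using @ren_ok_up; fail).
  constructor.
  - intros o Ho. rewrite op_clause_ren.
    destruct (op_clause H o) eqn:e; cbn; [discriminate|auto].
  - rewrite ret_clause_ren. eauto using @ren_ok_up.
  - intros o C. rewrite op_clause_ren.
    destruct (op_clause H o) eqn:e; cbn; [|discriminate].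
    intros [= <-]. eauto using @ren_ok_up.
Qed.

Lemma pair_typed G A B R V W :
  val_typed G V A -> val_typed G W B ->
  val_typed G (pair V W)
    (Arr (Arr A Esigma (Arr B Esigma R)) Esigma R).
Proof.
  intros hV hW. constructor. eapply T_Let with (T := Arr B Esigma R).
  - eapply T_App; [constructor; reflexivity|].
    eapply typed_ren; eauto. intros x T; auto.
  - eapply T_App; [constructor; reflexivity|].
    eapply typed_ren; eauto. intros x T; auto.
Qed.

Lemma tr_succ_typed G V : val_typed G V tr_nat -> val_typed G (tr_succ V) tr_nat.
Proof.
  intros hV. constructor. constructor; [now left|constructor|].
  eapply T_App; [|constructor].
  eapply typed_ren; eauto. intros x T; auto.
Qed.

Lemma tr_case_typed G V C D T :
  val_typed G V tr_nat -> comp_typed G Esigma C T ->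
  comp_typed (tr_nat :: G) Esigma D T ->
  comp_typed G Esigma (tr_case V C D) T.
Proof.
  intros hV hC hD. unfold tr_case.
  (* [B] types the thunk of the selected branch and [K] the consumer of a pair; the answer type of
     pairs is the type [T] of the whole case. *)
  set (B := Arr (Base Unit) Esigma T).
  set (K := Arr tr_nat Esigma (Arr B Esigma T)).
  apply T_Let with (T := Arr K Esigma T).
  - eapply T_Handle.
    + eapply T_App; [apply hV|constructor].
    + constructor.
      (* [sigma] is the only available effect and has a clause, so nothing is forwarded. *)
      * intros o []; subst; cbn; [discriminate|easy].
      * cbn. constructor. apply pair_typed; repeat constructor.
        eapply typed_ren; eauto. intros x U; auto.
      * intros o C'. cbn -[pair tr_succ op_eq_dec].
        destruct (op_eq_dec sigma o) as [<-|]; [|discriminate].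
        intros [= <-]. eapply T_Let.
        { eapply T_App; constructor. reflexivity. }
        constructor. constructor. eapply T_App; [constructor; reflexivity|].
        constructor. constructor. constructor.
        eapply T_App; [|constructor; reflexivity].
        apply pair_typed.
        { apply tr_succ_typed. constructor. reflexivity. }
        constructor. eapply typed_ren; eauto. intros [|x] U; auto.
  - eapply T_App; [constructor; reflexivity|].
    repeat constructor. eapply T_App; constructor. reflexivity.
Qed.

Scheme pcf_val_typed_mind := Minimality for PCF.val_typed Sort Prop
  with pcf_comp_typed_mind := Minimality for PCF.comp_typed Sort Prop.
Combined Scheme pcf_typed_ind from pcf_val_typed_mind, pcf_comp_typed_mind.

Lemma tr_typed :
  (forall G V T, PCF.val_typed G V T -> val_typed (map tr_ty G) (tr_val V) (tr_ty T)) /\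
  (forall G C T, PCF.comp_typed G C T ->
     comp_typed (map tr_ty G) Esigma (tr_comp C) (tr_ty T)).
Proof.
  apply pcf_typed_ind; cbn -[tr_succ tr_case]; intros;
    eauto using tr_succ_typed, tr_case_typed, val_typed, comp_typed.
  constructor. rewrite nth_error_map, H. reflexivity.
Qed.

(** * Type safety of PCF *)

Lemma pcf_typed_ren :
  (forall G V T, PCF.val_typed G V T ->
     forall G' r, ren_ok G G' r -> PCF.val_typed G' (PCF.ren_val r V) T) /\
  (forall G C T, PCF.comp_typed G C T ->
     forall G' r, ren_ok G G' r -> PCF.comp_typed G' (PCF.ren_comp r C) T).
Proof.
  apply pcf_typed_ind; cbn; intros; econstructor; eauto using @ren_ok_up.
Qed.

Definition pcf_subst_ok (G G' : list PCF.ty) (s : nat -> PCF.val) : Prop :=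
  forall x T, nth_error G x = Some T -> PCF.val_typed G' (s x) T.

Lemma pcf_subst_ok_up T G G' s :
  pcf_subst_ok G G' s -> pcf_subst_ok (T :: G) (T :: G') (PCF.up s).
Proof.
  intros h [|x] U e; cbn in *; [now constructor|].
  eapply pcf_typed_ren; [apply h, e|]. intros y; auto.
Qed.

Lemma pcf_typed_subst :
  (forall G V T, PCF.val_typed G V T ->
     forall G' s, pcf_subst_ok G G' s -> PCF.val_typed G' (PCF.subst_val s V) T) /\
  (forall G C T, PCF.comp_typed G C T ->
     forall G' s, pcf_subst_ok G G' s -> PCF.comp_typed G' (PCF.subst_comp s C) T).
Proof.
  apply pcf_typed_ind; cbn; intros; auto;
    econstructor; eauto using pcf_subst_ok_up.
Qed.

Lemma pcf_subst_ok_scons G W T :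
  PCF.val_typed G W T -> pcf_subst_ok (T :: G) G (scons W PCF.VVar).
Proof.
  intros h [|x] U; cbn; [now intros [= <-]|now constructor].
Qed.

Lemma pcf_preservation C C' T :
  PCF.step C C' -> PCF.comp_typed [] C T -> PCF.comp_typed [] C' T.
Proof.
  intros st. revert T. induction st; intros T h;
    inversion h as [|? ? ? ? ? hC hD|? ? ? ? ? hV hW|? ? ? ? ? hV hC hD]; subst; auto.
  - inversion hV; subst. eapply pcf_typed_subst; eauto using pcf_subst_ok_scons.
  - econstructor; eauto. inversion hV; subst.
    eapply pcf_typed_subst; eauto using pcf_subst_ok_scons.
  - inversion hC; subst. eapply pcf_typed_subst; eauto using pcf_subst_ok_scons.
  - econstructor; eauto.
  - inversion hV; subst. eapply pcf_typed_subst; eauto using pcf_subst_ok_scons.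
Qed.

Lemma pcf_closed_nat V : PCF.val_typed [] V PCF.Nat -> exists n, V = PCF.numeral n.
Proof.
  induction V; intros h; inversion h; subst.
  - destruct x; discriminate.
  - now exists 0.
  - destruct IHV as [n ->]; auto. now exists (S n).
Qed.

Lemma pcf_progress C T :
  PCF.comp_typed [] C T -> (exists V, C = PCF.CRet V) \/ exists C', PCF.step C C'.
Proof.
  revert T. induction C as [|C1 IH1 C2 _|V W|V C1 _ C2 _]; intros T h;
    inversion h as [|? ? ? ? ? hC hD|? ? ? ? ? hV hW|? ? ? ? ? hV hC hD];
    subst; eauto; right.
  - destruct (IH1 _ hC) as [[V ->]|[C' st]]; eauto using PCF.step.
  - inversion hV as [? x ? e| | | |]; subst; eauto using PCF.step.
    destruct x; discriminate.
  - destruct (pcf_closed_nat _ hV) as [[|n] ->]; cbn; eauto using PCF.step.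
Qed.

(** * Reduction in HEPCF *)

Notation steps1 := (clos_trans comp step).

Lemma steps_let C C' D : steps C C' -> steps (CLet C D) (CLet C' D).
Proof. induction 1; [apply rt_step; now constructor|apply rt_refl|eapply rt_trans; eauto]. Qed.

Lemma steps1_let C C' D : steps1 C C' -> steps1 (CLet C D) (CLet C' D).
Proof. induction 1; [apply t_step; now constructor|eapply t_trans; eauto]. Qed.

Lemma steps_handle H C C' : steps C C' -> steps (CHandle H C) (CHandle H C').
Proof. induction 1; [apply rt_step; now constructor|apply rt_refl|eapply rt_trans; eauto]. Qed.

Lemma terminal_normal C C' : terminal C -> ~ step C C'.
Proof. intros t st. destruct st; contradiction. Qed.

Lemma step_det C C1 C2 : step C C1 -> step C C2 -> C1 = C2.
Proof.
  intros st. revert C2. induction st; intros C2 st2; inversion st2; subst; auto;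
    try match goal with
        | h : step (CRet _) _ |- _ => destruct (terminal_normal (CRet _) _ I h)
        | h : step (COp _ _ _) _ |- _ => destruct (terminal_normal (COp _ _ _) _ I h)
        end;
    try congruence; try (f_equal; auto; fail).
  (* What remains is [S_Case]: inversion yields equal dependent pairs over the number of branches,
     and decidable equality on [nat] makes them injective. *)
  repeat match goal with
  | h : existT _ _ _ = existT _ _ _ |- _ =>
      apply (inj_pair2_eq_dec _ Nat.eq_dec) in h
  end.
  congruence.
Qed.

Lemma steps_terminal_unique C N N' :
  steps C N -> terminal N -> steps C N' -> terminal N' -> N = N'.
Proof.
  intros h%clos_rt_rt1n tN h' tN'. revert h'.
  induction h as [C|C C1 N st _ IH]; intros h'%clos_rt_rt1n; inversion h'; subst.
  - reflexivity.
  - destruct (terminal_normal _ _ tN H).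
  - destruct (terminal_normal _ _ tN' st).
  - rewrite (step_det _ _ _ st H) in IH. apply clos_rt1n_rt in H0. auto.
Qed.

(** By determinism the given finite reduction is the only one, so every reduction from [C] stops
    with it. *)
Lemma steps_terminal_acc C N :
  steps C N -> terminal N -> Acc (fun C' C => step C C') C.
Proof.
  intros h%clos_rt_rt1n tN. induction h as [C|C C1 N st _ IH]; constructor; intros C' st'.
  - destruct (terminal_normal _ _ tN st').
  - rewrite (step_det _ _ _ st' st). auto.
Qed.

(** By determinism [C'] lies on the path from [C] to [N], and no step leads beyond the terminal
    [N]. *)
Lemma steps_steps1_terminal C C' N :
  steps1 C C' -> steps C N -> terminal N -> steps C' N.
Proof.
  intros h1%clos_trans_t1n h2 tN. revert h2.
  assert (one : forall C C', step C C' -> steps C N -> steps C' N).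
  { intros A B st h%clos_rt_rt1n. inversion h; subst.
    - destruct (terminal_normal _ _ tN st).
    - rewrite (step_det _ _ _ st H). now apply clos_rt1n_rt. }
  induction h1; eauto.
Qed.

(** * Evaluation and effect trees *)

Lemma eval_steps C N : steps C N -> terminal N -> eval C = Some N.
Proof.
  intros h t. unfold eval.
  destruct (excluded_middle_informative _) as [e|e]; [|destruct e; eauto].
  destruct (constructive_indefinite_description _ _) as [N' [h' t']].
  cbn. f_equal. eauto using steps_terminal_unique.
Qed.

Lemma ET_unfold C :
  ET C = match eval C with
         | Some (CRet V) => Leaf V
         | Some (COp o V D) => Node o V (fun i => ET (inst D (VFin i)))
         | _ => Bot
         end.
Proof.
  (* A cofixpoint unfolds only when it is scrutinised, hence the detour through this [match], which
     rebuilds the tree. *)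
  transitivity (match ET C with
                | Bot => Bot | Leaf V => Leaf V | Node o V ts => Node o V ts end).
  - now destruct (ET C).
  - cbn. destruct (eval C) as [[]|]; reflexivity.
Qed.

Lemma ET_diverge C : ~ (exists N, steps C N /\ terminal N) -> ET C = Bot.
Proof.
  intros h. rewrite ET_unfold. unfold eval.
  destruct (excluded_middle_informative _); [contradiction|reflexivity].
Qed.

(** * Simulation of [case] *)

(* The unary number is recovered by nested calls: the pair for [S m] calls the
   pair for [m], whose continuation forms the pair for [S m]. Unfolding these calls
   gives the branch actually selected, see [case_pair_app]. *)
Fixpoint case_pair (C D : comp) (n : nat) : val :=
  match n with
  | 0 => pair tr_zero (VLam (ren_comp S C))
  | S m =>
      VLam (CApp (ren_val S (case_pair C D m))
        (VLam (CRet (VLam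
          (CApp (pair (tr_succ (VVar 1))
                      (VLam (ren_comp (scons 2 (fun x => 4 + x)) D)))
                (VVar 2))))))
  end.

Definition case_branch (C D : comp) (n : nat) : comp :=
  match n with 0 => C | S m => inst D (num m) end.

Lemma inst_val_ren_S U V : inst_val (ren_val S U) V = U.
Proof. unfold inst_val. rewrite (proj1 subst_ren). apply subst_id. Qed.

Lemma inst_ren_handler_S H V : subst_handler (scons V VVar) (ren_handler S H) = H.
Proof. rewrite (proj2 (proj2 subst_ren)). apply subst_id. Qed.

Lemma num_succ n : num (S n) = VLam (COp sigma VUnit (CApp (num n) VUnit)).
Proof. cbn. unfold tr_succ. rewrite ren_num. reflexivity. Qed.

Lemma inst_num_app n V : inst (CApp (num n) VUnit) V = CApp (num n) VUnit.
Proof. unfold inst. cbn. rewrite subst_num. reflexivity. Qed.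

Lemma num_app_succ n :
  step (CApp (num (S n)) VUnit) (COp sigma VUnit (CApp (num n) VUnit)).
Proof.
  rewrite num_succ. eapply eq_ind; [constructor|].
  unfold inst; cbn. unfold up; now rewrite subst_num.
Qed.

Lemma steps_eq C C' : C = C' -> steps C C'.
Proof. intros ->. apply rt_refl. Qed.

Lemma pair_app V W K :
  steps (CApp (pair V W) K) (CLet (CApp K V) (CApp (VVar 0) (ren_val S W))).
Proof.
  eapply rt_trans; [apply rt_step; constructor|].
  apply steps_eq. compare_substs.
Qed.

(** The handler is deep: when its [sigma] clause fires, the resumption runs the predecessor under
    the same handler, so the induction hypothesis yields the recursive pair. *)
Lemma handle_num C D n :
  steps (CHandle (case_handler C D) (CApp (num n) VUnit)) (CRet (case_pair C D n)).
Proof.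
  induction n as [|n IH].
  - eapply rt_trans; [apply steps_handle, rt_step; constructor|].
    eapply rt_trans; [apply rt_step; constructor|].
    apply steps_eq. compare_substs.
  - eapply rt_trans; [apply steps_handle, rt_step, num_app_succ|].
    eapply rt_trans; [apply rt_step; eapply S_HandleOp; reflexivity|].
    eapply rt_trans.
    (* The call [r 0] reinstates the handler; instantiating the binder of the resumption undoes the
       shift of the handler. *)
    { apply (steps_let _ (CRet (case_pair C D n))).
      eapply rt_trans; [apply rt_step; constructor|].
      eapply rt_trans; [|apply IH].
      apply steps_eq. unfold inst. cbn. rewrite subst_num. f_equal.
      apply (inst_ren_handler_S (case_handler C D)). }
    eapply rt_trans; [apply rt_step; constructor|].
    (* Substituting for [x], [r] and [p] removes three binders, which turns the offset 7 of
       [case_handler] into the 4 of [case_pair]. *)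
    apply steps_eq. compare_substs.
Qed.

Lemma case_pair_app C D n K :
  steps (CApp (case_pair C D n) K)
    (CLet (CApp K (num n))
       (CApp (VVar 0) (ren_val S (VLam (ren_comp S (case_branch C D n)))))).
Proof.
  (* [K] must vary: the pair for the predecessor is applied to the continuation that forms the outer
     pair. *)
  revert K. induction n as [|n IH]; intros K.
  - apply pair_app.
  - eapply rt_trans; [apply rt_step; constructor|].
    eapply rt_trans.
    { apply steps_eq. apply (f_equal2 CApp (inst_val_ren_S _ _) eq_refl). }
    eapply rt_trans; [apply IH|].
    (* That continuation keeps the copy [num n] but drops the thunk of the branch for [n], and pairs
       the successor with a thunk of [D] at [num n]. *)
    eapply rt_trans; [apply steps_let, rt_step; constructor|].
    eapply rt_trans; [apply rt_step; constructor|].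
    eapply rt_trans; [apply rt_step; constructor|].
    eapply rt_trans; [|apply pair_app].
    apply steps_eq. compare_substs.
Qed.

Lemma tr_case_steps C D n :
  steps1 (tr_case (num n) C D) (case_branch C D n).
Proof.
  apply clos_rt_t with
    (CLet (CRet (case_pair C D n))
       (CApp (VVar 0) (VLam (CRet (VLam (CApp (VVar 0) VUnit)))))).
  { apply steps_let, handle_num. }
  eapply t_trans; [apply t_step; constructor|].
  eapply clos_rt_t; [apply case_pair_app|].
  (* The last consumer, [fun n b => b ()], ignores the copy and forces the thunk. *)
  eapply t_trans; [apply t_step, S_Let, S_Beta|].
  eapply t_trans; [apply t_step, S_LetRet|].
  eapply t_trans; [apply t_step, S_Beta|].
  eapply eq_ind; [apply t_step, S_Beta|]. compare_substs.
Qed.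

(** * Simulation of PCF reduction *)

Lemma tr_step C C' T :
  PCF.comp_typed [] C T -> PCF.step C C' -> steps1 (tr_comp C) (tr_comp C').
Proof.
  intros h st. revert T h. induction st; intros T h; cbn -[tr_case tr_succ].
  - rewrite tr_inst. apply t_step. constructor.
  - rewrite tr_inst_val. apply t_step. constructor.
  - rewrite tr_inst. apply t_step. constructor.
  - inversion h; subst. eapply steps1_let, IHst; eauto.
  - apply (tr_case_steps _ _ 0).
  (* Typing makes the closed predecessor a numeral, the form in which [tr_case_steps] applies. *)
  - inversion h as [| | |? ? ? ? ? hV]; subst. inversion hV as [| |? ? hV'| |]; subst.
    destruct (pcf_closed_nat _ hV') as [n ->].
    rewrite tr_inst. apply (tr_case_steps _ _ (S n)).
Qed.

Lemma tr_steps C C' T :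
  PCF.comp_typed [] C T -> PCF.steps C C' ->
  PCF.comp_typed [] C' T /\ steps (tr_comp C) (tr_comp C').
Proof.
  intros h st. revert h. induction st; intros h.
  - split; [eauto using pcf_preservation|]. eapply clos_t_clos_rt, tr_step; eauto.
  - split; [auto|apply rt_refl].
  - destruct IHst1 as [h1 s1]; auto. destruct IHst2 as [h2 s2]; auto.
    split; [auto|eapply rt_trans; eauto].
Qed.

Lemma pcf_normal_nat N :
  PCF.comp_typed [] N PCF.Nat -> PCF.normal N -> exists n, N = PCF.CRet (PCF.numeral n).
Proof.
  intros h hN. destruct (pcf_progress _ _ h) as [[V ->]|[C' st]].
  - inversion h as [? ? ? hV| | |]; subst.
    destruct (pcf_closed_nat _ hV) as [n ->]. eauto.
  - destruct (hN _ st).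
Qed.

(** * Trees of numerals, and divergence *)

Lemma ET_num C n : steps C (CApp (num n) VUnit) -> tree_eq (ET C) (nat_tree n).
Proof.
  (* Although [tree_eq] is coinductive, induction on [n] suffices because [nat_tree n] is finite.
     Allowing any [C] that reduces to the numeral's thunk call covers [Cf] itself. *)
  revert C. induction n as [|n IH]; intros C h; rewrite ET_unfold.
  - rewrite (eval_steps C (CRet VUnit)); [constructor| |exact I].
    eapply rt_trans; [apply h|]. apply rt_step. constructor.
  - rewrite (eval_steps C (COp sigma VUnit (CApp (num n) VUnit))).
    + constructor. intros i. rewrite inst_num_app. apply IH, rt_refl.
    + eapply rt_trans; [apply h|]. apply rt_step, num_app_succ.
    + exact I.
Qed.

(* Determinism makes the translation accessible for (transitive) reduction; this
   well-founded order decreases along PCF steps, which take at least one step each. *)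
Lemma tr_terminal_normalises C T D N :
  PCF.comp_typed [] C T -> steps (CLet (tr_comp C) D) N -> terminal N ->
  exists N', PCF.normal_form_of C N'.
Proof.
  intros h hN tN.
  pose proof (steps_terminal_acc _ _ hN tN) as a%Acc_clos_trans.
  remember (CLet (tr_comp C) D) as A eqn:e. revert C h e hN.
  induction a as [A _ IH]. intros C h -> hN.
  destruct (pcf_progress _ _ h) as [[V ->]|[C' st]].
  - exists (PCF.CRet V). split; [apply rt_refl|]. intros C' st. inversion st.
  - pose proof (steps1_let _ _ D (tr_step _ _ _ h st)) as st1.
    (* Accessibility concerns the converse of [step], so the transitive closure has to be
       transposed. *)
    destruct (IH _ (proj1 (clos_trans_transp_permute _ _ _ _) st1) C') as [N' [hs hN']];
      eauto using pcf_preservation, steps_steps1_terminal.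
    exists N'. split; [|exact hN']. eapply rt_trans; [apply rt_step, st|exact hs].
Qed.

Theorem theorem8p10 (C : PCF.comp) (hC : PCF.comp_typed nil C PCF.Nat) :
  let Cf := HEPCF.CLet (Translation.tr_comp C)
                       (HEPCF.CApp (HEPCF.VVar 0) HEPCF.VUnit) in
  HEPCF.comp_typed nil Translation.Esigma Cf (HEPCF.Base HEPCF.Unit) /\
  (forall N : PCF.comp, PCF.normal_form_of C N ->
     exists n : nat,
       N = PCF.CRet (PCF.numeral n) /\
       HEPCF.tree_eq (HEPCF.ET Cf) (Translation.nat_tree n)) /\
  (~ (exists N : PCF.comp, PCF.normal_form_of C N) ->
     HEPCF.tree_eq (HEPCF.ET Cf) HEPCF.Bot).
Proof.
  intros Cf. split; [|split].
  - eapply T_Let; [apply (proj2 tr_typed _ _ _ hC)|].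
    eapply T_App; constructor. reflexivity.
  - intros N [st hN]. destruct (tr_steps _ _ _ hC st) as [h st'].
    destruct (pcf_normal_nat _ h hN) as [n ->].
    exists n. split; [reflexivity|]. apply ET_num.
    eapply rt_trans; [apply steps_let, st'|]. apply rt_step. constructor.
  - intros hC'. rewrite ET_diverge; [constructor|].
    (* A terminal reduct of [Cf] would give [C] a normal form. *)
    intros [N [st tN]]. eauto using tr_terminal_normalises.
Qed.
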